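(* The index $CI^{*}$ is strongly upper bounded: for all $m\ge 2$, all pairwise comparison matrices $\mathbf{A}_1,\ldots,\mathbf{A}_m\in\mathcal{A}$ of the same order and all $\boldsymbol{\lambda}\in\mathcal{L}_m$, $$CI^{*}(\mathbf{A}^{\star})\le \sum_{h=1}^m\lambda_h\, CI^{*}(\mathbf{A}_h).$$
   Context: A pairwise comparison matrix of order $n$ is a real $n\times n$ matrix $\mathbf{A}=(a_{ij})$ with $a_{ij}>0$ and $a_{ij}a_{ji}=1$ for all $i,j$. $\mathcal{A}$ is the set of all pairwise comparison matrices of all orders $n>2$. $\mathcal{L}_m=\{(\lambda_1,\ldots,\lambda_m): \lambda_h\ge 0\ \forall h,\ \sum_{h=1}^m\lambda_h=1\}$. Given $\mathbf{A}_h=(a_{ij}^{(h)})_{n\times n}\in\mathcal{A}$, $h=1,\ldots,m$ (same order $n$), and $\boldsymbol{\lambda}\in\mathcal{L}_m$, the aggregated matrix $\mathbf{A}^{\star}=(a_{ij}^{\star})_{n\times n}$ is $a_{ij}^{\star}=\prod_{h=1}^m (a_{ij}^{(h)})^{\lambda_h}$. For $\mathbf{A}\in\mathcal{A}$ of order $n$, $$CI^{*}(\mathbf{A})=\frac{1}{\binom{n}{3}}\sum_{i=1}^{n-2}\sum_{j=i+1}^{n-1}\sum_{k=j+1}^{n}\left(\frac{a_{ij}a_{jk}}{a_{ik}}+\frac{a_{ik}}{a_{ij}a_{jk}}-2\right).$$ *)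

(* Defs.v *)
From HB Require Import structures.
From mathcomp Require Import all_boot all_order all_algebra.
From mathcomp Require Import reals exp.

Set Implicit Arguments.
Unset Strict Implicit.
Unset Printing Implicit Defensive.

Import Order.TTheory GRing.Theory Num.Theory.

Local Open Scope ring_scope.

Definition pairwise_comparison (R : realType) (n : nat) (A : 'M[R]_n) : Prop :=
  (forall i j, 0 < A i j) /\ (forall i j, A i j * A j i = 1).

Definition weight_vector (R : realType) (m : nat) (lambda : 'I_m -> R) : Prop :=
  (forall h, 0 <= lambda h) /\ \sum_(h < m) lambda h = 1.

(* For a positive base a, powR a x is the usual real power exp (x ln a). *)
Definition aggregate (R : realType) (m n : nat) (lambda : 'I_m -> R)
    (A : 'I_m -> 'M[R]_n) : 'M[R]_n :=
  \matrix_(i, j) \prod_(h < m) (A h i j `^ lambda h).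

(* Indices run over 0, ..., n - 1; the triples are exactly those with
   i < j < k. *)
Definition CI_star (R : realType) (n : nat) (A : 'M[R]_n) : R :=
  ('C(n, 3)%:R)^-1 *
  \sum_(i < n) \sum_(j < n | (i < j)%N) \sum_(k < n | (j < k)%N)
    (A i j * A j k / A i k + A i k / (A i j * A j k) - 2).

(* An index assigns a real number to matrices of every order n; only orders
   n > 2 matter, as these are the orders of the matrices it is meant for. *)
Definition strongly_upper_bounded (R : realType)
    (I : forall n : nat, 'M[R]_n -> R) : Prop :=
  forall (m n : nat) (A : 'I_m -> 'M[R]_n) (lambda : 'I_m -> R),
    (2 <= m)%N -> (2 < n)%N ->
    (forall h, pairwise_comparison (A h)) ->
    weight_vector lambda ->
    I n (aggregate lambda A) <= \sum_(h < m) lambda h * I n (A h).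

(* Main.v *)
Require Import Defs.
From mathcomp Require Import all_boot all_order all_algebra.
From mathcomp Require Import reals sequences exp.

(** Each summand of CI* is x + 1/x - 2 with x = a_ij a_jk / a_ik.  Weighted
    geometric means commute with products and inverses, so the aggregated x is
    the weighted geometric mean of the individual ones, and likewise for 1/x;
    the weighted AM-GM inequality, applied to both, concludes. *)

Set Implicit Arguments.
Unset Strict Implicit.
Unset Printing Implicit Defensive.

Import Order.TTheory GRing.Theory Num.Theory.

Local Open Scope ring_scope.

Definition weighted_gmean (R : realType) (m : nat) (lambda t : 'I_m -> R) : R :=
  \prod_(h < m) (t h `^ lambda h).

Lemma weighted_gmeanM (R : realType) (m : nat) (lambda t u : 'I_m -> R) :
  (forall h, 0 <= t h) -> (forall h, 0 <= u h) ->
  weighted_gmean lambda (fun h => t h * u h) =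
  weighted_gmean lambda t * weighted_gmean lambda u.
Proof.
move=> t0 u0; rewrite /weighted_gmean -big_split /=.
by apply: eq_bigr => h _; rewrite powRM.
Qed.

Lemma weighted_gmeanV (R : realType) (m : nat) (lambda t : 'I_m -> R) :
  (forall h, 0 <= t h) ->
  weighted_gmean lambda (fun h => (t h)^-1) = (weighted_gmean lambda t)^-1.
Proof.
move=> t0; rewrite /weighted_gmean -prodfV.
(* Inversion is the power [-1], and iterated exponents commute. *)
by apply: eq_bigr => h _; rewrite -powR_inv1 // powRAC powR_inv1 // powR_ge0.
Qed.

Lemma weighted_AMGM (R : realType) (m : nat) (lambda t : 'I_m -> R) :
  weight_vector lambda -> (forall h, 0 < t h) ->
  weighted_gmean lambda t <= \sum_(h < m) lambda h * t h.
Proof.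
move=> [l0 l1] t0; set p := \sum_(h < m) lambda h * ln (t h).
have -> : weighted_gmean lambda t = expR p.
  (* [powR] treats base 0 separately; [t h > 0] selects the exponential branch. *)
  by rewrite expR_sum; apply: eq_bigr => h _; rewrite /powR gt_eqF.
(* Tangent line of exp at p: its first-order term averages to zero. *)
have -> : expR p = \sum_(h < m) lambda h * (expR p * (1 + (ln (t h) - p))).
  under eq_bigr => h _ do rewrite mulrCA mulrDr mulr1 mulrBr.
  by rewrite -mulr_sumr big_split /= sumrB -mulr_suml l1 mul1r subrr addr0 mulr1.
apply: ler_sum => h _; apply: ler_wpM2l; first exact: l0.
(* Factor [t h] as [expR (ln (t h) - p) * expR p] and use [1 + x <= expR x] at
   [x = ln (t h) - p]. *)
rewrite -[leRHS](lnK (t0 h)) -{2}(subrK p (ln (t h))) expRD mulrC.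
by rewrite ler_wpM2r ?expR_ge0 ?expR_ge1Dx.
Qed.

Theorem proposition4 (R : realType) : strongly_upper_bounded (@CI_star R).
Proof.
move=> m n A lambda _ _ pcA wl; rewrite /CI_star.
(* Moving the sum over [h] innermost reduces the claim to one fixed triple [i < j < k]. *)
under [leRHS]eq_bigr do rewrite mulrCA.
rewrite -mulr_sumr ler_wpM2l ?invr_ge0 ?ler0n //.
under [leRHS]eq_bigr do rewrite mulr_sumr.
rewrite exchange_big; apply: ler_sum => i _ /=.
under [leRHS]eq_bigr do rewrite mulr_sumr.
rewrite exchange_big; apply: ler_sum => j _ /=.
under [leRHS]eq_bigr do rewrite mulr_sumr.
rewrite exchange_big; apply: ler_sum => k _ /=.
have A0 h a b : 0 < A h a b by case: (pcA h).
have Age0 h a b : 0 <= A h a b by exact: ltW.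
have aggE a b : aggregate lambda A a b = weighted_gmean lambda (fun h => A h a b).
  by rewrite mxE.
under [leRHS]eq_bigr do rewrite mulrBr mulrDr.
(* As the weights sum to 1, the constant 2 averages to itself and cancels. *)
rewrite sumrB big_split /= -mulr_suml (proj2 wl) mul1r lerD2r !aggE.
rewrite -weighted_gmeanM // -!weighted_gmeanV -?weighted_gmeanM //.
- by apply: lerD; apply: weighted_AMGM => // h; rewrite ?(mulr_gt0, invr_gt0).
all: by move=> h; rewrite ?(mulr_ge0, invr_ge0).
Qed.
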